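(* Let $(m_i,p_i)_{i=1,\dots,n}$ be a branching random walk on $\mathbb{R}$ (as defined in the context). Assume: (a) $m_i$ is position-independent, i.e. for each $i$ the expected number of offspring $m_i(u)=m_i$ does not depend on the position $u$ of the parent; (b) a Chernoff bound holds for the random walk $(p_i)$: there is a constant $c>0$ (which may depend on $n$) such that, if $S_n=X_1+\cdots+X_n$ is the position at time $n$ of the random walk $(p_i)$, then $$\Pr\big(|S_n-\mathbf{E}(S_n)|\ge \lambda\big)\le e^{-c\lambda^2/n}\qquad\text{for all }\lambda>0 .$$ Let $n\mu=\mathbf{E}(S_n)$ be the expected position of an individual in generation $n$. Then for every $\lambda>0$ and every $$\alpha\in\Big[e^{-\frac12 c\lambda^2/n},\;1-e^{-\frac12 c\lambda^2/n}\Big],$$ the $\alpha$-quantile $Q_n(\alpha)$ of the positions of the individuals in generation $n$ satisfies $$\Pr\big(|Q_n(\alpha)-n\mu|\ge\lambda\big)\le 2e^{-\frac12 c\lambda^2/n},$$ where the probability is over the random trees whose generation $n$ is non-empty.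
   Context: Branching random walk (BRW). One initial ancestor (generation $0$) sits at the origin of $\mathbb{R}$. Each individual of generation $i-1$ located at $u$ produces a random number $\mathcal{N}$ of children (generation $i$), with expected number $\mathbf{E}[\mathcal{N}]=m_i(u)$. Each child is placed at $u$ plus its displacement, and the displacement of a single child has probability density (or, in the discrete case, mass function) $p_i(\cdot\mid u)$. The number $\mathcal{N}$ of children of a parent is independent of the displacements of those children, so that the intensity measure of the children's displacements from a parent at $u$ is $m_i(u)\,p_i(x\mid u)\,dx$. The displacements of siblings are not assumed independent of each other, and the branching factors and displacement laws may vary across generations. The process may be supercritical or subcritical. A realization is a random rooted tree whose nodes carry positions. The BRW is specified by, and denoted by, the sequence of pairs $(m_i,p_i)_{i=1,2,\dots}$. Spines. For an individual of generation $n$, the displacements $(x_1,\dots,x_n)$ along its ancestral line from the root form its spine, and its position is $x_1+\cdots+x_n$. Over the forest grown from infinitely many initial ancestors, the proportion of spines $(x_1,\dots,x_n)$ has density proportional to $\prod_{i=1}^n m_i(u_{i-1})\,p_i(x_i\mid u_{i-1})$, where $u_0=0$ and $u_{i-1}=x_1+\cdots+x_{i-1}$. When each $m_i$ is position-independent this density is $\prod_{i=1}^n p_i(x_i\mid u_{i-1})$. Random walk $(p_i)$. This is the non-branching process $S_0=0$, $S_k=X_1+\cdots+X_k$, in which, given $X_1,\dots,X_{i-1}$, the increment $X_i$ has density (or mass function) $p_i(\cdot\mid S_{i-1})$, so that $(X_1,\dots,X_n)$ has joint density $\prod_{i=1}^n p_i(x_i\mid u_{i-1})$. It is assumed that $\mathbf{E}(S_n)$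 is finite. The notation $n\mu$ for the mean does not indicate linear dependence on $n$. Quantile. Let $z_1,\dots,z_Z$ be an enumeration of the positions of the individuals of generation $n$ of a tree, where $Z\ge1$ is their number. For $\alpha\in(0,1)$, $$Q_n(\alpha)=\inf\Big\{t\in\mathbb{R}:\ \frac1Z\sum_{j=1}^{Z}\mathbf{1}_{\{z_j\le t\}}\ge\alpha\Big\}.$$ This is a random variable depending on the random tree.
   Formalization: The law of a parent's number of children is assumed to depend on the parent's position u only through its mean m_i(u), so under (a) the whole offspring law, not just its mean, is position-independent; without this the claim is false. *)

(* Defs.v *)
From HB Require Import structures.
From mathcomp Require Import all_boot all_order all_algebra.
From mathcomp Require Import all_classical all_reals all_analysis.

Set Implicit Arguments.
Unset Strict Implicit.
Unset Printing Implicit Defensive.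

Import Order.TTheory GRing.Theory Num.Theory.
Import numFieldNormedType.Exports.

Local Open Scope classical_set_scope.
Local Open Scope ring_scope.

(* Real sequences with the product sigma-algebra: the displacements of all
   (potential) children of one individual. *)
Definition siblings (R : realType) : Type :=
  g_sigma_algebraType
    [set C : set (nat -> R) | exists (j : nat) (B : set R),
       measurable B /\ C = [set x | B (x j)]].

HB.instance Definition _ (R : realType) := Measurable.on (siblings R).

Definition law_of_density (R : realType) (discrete : bool) (f : R -> R)
    (B : set R) : \bar R :=
  if discrete then (\esum_(x in B) (f x)%:E)%E
  else (\int[lebesgue_measure]_(x in B) (f x)%:E)%E.

(* The n-generation branching random walk (m_i, p_i), 1 <= i <= n. The index i
   is the generation of the children, [brw_p i u x] stands for p_i(x | u), and
   [offspring i u], [sibling_disp i u] are the laws of the number of children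
   and of the displacements of the children of a parent located at u. *)
Record brw (R : realType) (n : nat) := Brw {
  brw_m : nat -> R -> R;
  brw_p : nat -> R -> R -> R;
  is_discrete : nat -> bool;
  offspring : nat -> (R.-pker R ~> nat);
  sibling_disp : nat -> (R.-pker R ~> siblings R);
  offspring_mean : forall i u, (0 < i <= n)%N ->
    (\int[offspring i u]_(k in [set: nat]) (k%:R)%:E)%E = (brw_m i u)%:E;
  (* the process is specified by (m_i, p_i): the position u of a parent acts
     on the law of its number of children only through m_i(u). *)
  offspring_only_m : forall i u v, (0 < i <= n)%N -> brw_m i u = brw_m i v ->
    forall B : set nat, offspring i u B = offspring i v B;
  p_ge0 : forall i u x, (0 < i <= n)%N -> 0 <= brw_p i u x;
  p_measurable : forall i u, (0 < i <= n)%N -> ~~ is_discrete i ->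
    measurable_fun [set: R] (brw_p i u);
  (* each child's displacement has density p_i(. | u); nothing is assumed on
     the dependence between siblings. *)
  sibling_marginal : forall i u (j : nat) (B : set R), (0 < i <= n)%N ->
    measurable B ->
    sibling_disp i u [set x : siblings R | B (x j)]
      = law_of_density (is_discrete i) (brw_p i u) B
}.

(* Individuals carry Ulam-Harris labels: the root is [::] and the children of
   v are rcons v 0, rcons v 1, ... Reproduction data are attached to every
   label; those of labels not belonging to the tree are ignored by
   [generation]. *)
Definition position (R : realType) (T : Type)
    (D : seq nat -> T -> siblings R) (v : seq nat) (w : T) : R :=
  \sum_(k < size v) D (take k v) w (nth 0%N v k).

Definition history (R : realType) (T : Type) (N : seq nat -> T -> nat)
    (D : seq nat -> T -> siblings R) (k : nat) : set (set T) :=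
  <<s [set E | exists2 v : seq nat, (size v < k)%N &
         (exists c : nat, E = N v @^-1` [set c]) \/
         (exists2 C : set (siblings R), measurable C & E = D v @^-1` C)] >>.

(* Conditionally on the generations up to k, the labels of length k
   reproduce independently, each with the law of (number of children,
   displacements) being the product of [offspring] and [sibling_disp] at its
   position. The conditional law is expressed by its defining integral
   identity on history events and rectangles. *)
Record random_tree (R : realType) (n : nat) (b : brw R n) d
    (T : measurableType d) (P : probability T R) := RandomTree {
  nchildren : seq nat -> T -> nat;
  disp : seq nat -> T -> siblings R;
  nchildren_measurable : forall v, measurable_fun [set: T] (nchildren v);
  disp_measurable : forall v, measurable_fun [set: T] (disp v);
  branching : forall (k : nat) (E : set T) (s : seq (seq nat))
      (c : seq nat -> nat) (C : seq nat -> set (siblings R)),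
    (k < n)%N -> history nchildren disp k E ->
    uniq s -> (forall v, v \in s -> size v = k) ->
    (forall v, measurable (C v)) ->
    P (E `&` [set w | forall v, v \in s ->
                 nchildren v w = c v /\ C v (disp v w)])
    = (\int[P]_(w in E) \prod_(v <- s)
         (offspring b k.+1 (position disp v w) [set c v]
          * sibling_disp b k.+1 (position disp v w) (C v)))%E
}.

Section tree_observables.
Context (R : realType) (n : nat) (b : brw R n) (d : measure_display)
  (T : measurableType d) (P : probability T R) (t : random_tree b P).

Fixpoint generation (k : nat) (w : T) : seq (seq nat) :=
  if k is k'.+1 then
    [seq rcons v j | v <- generation k' w, j <- iota 0 (nchildren t v w)]
  else [:: [::]].

Definition gen_positions (k : nat) (w : T) : seq R :=
  [seq position (disp t) v w | v <- generation k w].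

Definition gen_size (k : nat) (w : T) : nat := size (generation k w).

(* Only meaningful when gen_size k w > 0. *)
Definition quantile (k : nat) (alpha : R) (w : T) : R :=
  inf [set x : R |
    alpha <= (count (fun z => z <= x) (gen_positions k w))%:R
             / (gen_size k w)%:R].

End tree_observables.

Definition walk (R : realType) (T : Type) (X : nat -> T -> R) (k : nat)
    (w : T) : R := \sum_(1 <= i < k.+1) X i w.

(* X_1, ..., X_n (X 0 is unused): given X_1, ..., X_(i-1), the increment X_i
   has density p_i(. | S_(i-1)). *)
Record is_random_walk (R : realType) (n : nat) (b : brw R n) d
    (T : measurableType d) (P : probability T R) (X : nat -> T -> R) : Prop :=
  IsRandomWalk {
    step_measurable : forall i, (0 < i <= n)%N ->
      measurable_fun [set: T] (X i);
    step_law : forall (i : nat) (E : set T) (B : set R), (0 < i <= n)%N ->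
      <<s [set F | exists j : nat, (0 < j < i)%N /\
             exists2 A : set R, measurable A & F = X j @^-1` A] >> E ->
      measurable B ->
      P (E `&` X i @^-1` B)
      = (\int[P]_(w in E)
           law_of_density (is_discrete b i) (brw_p b i (walk X i.-1 w)) B)%E
  }.

(* Equal to 0 when B has probability 0. *)
Definition cond_prob (R : realType) d (T : measurableType d)
    (P : probability T R) (A B : set T) : R :=
  fine (P (A `&` B)) / fine (P B).

(* Main.v *)
From HB Require Import structures.
Require Import Defs.
From mathcomp Require Import all_boot all_order all_algebra.
From mathcomp Require Import all_classical all_reals all_analysis.
From mathcomp Require Import measurable_realfun ring lra.

Set Implicit Arguments.
Unset Strict Implicit.
Unset Printing Implicit Defensive.

Import Order.TTheory GRing.Theory Num.Theory.
Import numFieldNormedType.Exports.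

Local Open Scope classical_set_scope.
Local Open Scope ring_scope.

(* Conditionally on the numbers of children of all individuals of generations
   below n, each fixed label of generation n has a position distributed as the
   random walk S_n: since m_i does not depend on the position, the tree shape
   carries no information on the displacements. By Chernoff, the expected
   proportion of individuals of generation n at distance at least lambda from
   n mu is thus at most theta^2 on every shape, with
   theta = exp(-c lambda^2 / (2n)). If the alpha-quantile deviates by lambda,
   this proportion is at least min(alpha, 1 - alpha) >= theta, which by Markov's
   inequality has conditional probability at most theta. There are countably
   many shapes, and summing over them concludes. *)

(** * Measure-theoretic preliminaries: restriction, and uniqueness of joint laws *)

Lemma measurable_preimage d d' (T : measurableType d) (U : measurableType d')
    (f : T -> U) (B : set U) :
  measurable_fun [set: T] f -> measurable B -> measurable (f @^-1` B).
Proof. by move=> mf mB; rewrite -[_ @^-1` _]setTI; exact: mf. Qed.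

(** The part of [D] outside [E] is null for the restricted measure, and on subsets of [D] inside [E]
    the two measures agree. *)
Lemma ge0_integral_mrestr d (T : measurableType d) (R : realType)
    (m : {measure set T -> \bar R}) (E D : set T) (mE : measurable E)
    (f : T -> \bar R) :
  measurable D -> measurable_fun D f -> (forall x, 0 <= f x)%E ->
  (\int[mrestr m mE]_(x in D) f x = \int[m]_(x in D `&` E) f x)%E.
Proof.
move=> mD mf f0.
have mDE : measurable (D `&` E) by exact: measurableI.
have mDE' : measurable (D `\` E) by exact: measurableD.
rewrite -{1}(setUIDK D E) ge0_integral_setU//; last 2 first.
- by rewrite setUIDK.
- by apply/disj_setPLR => x [_ Ex] [].
rewrite [X in (_ + X)%E]null_set_integral ?adde0//.
- apply: eq_measure_integral => A mA AD /=.
  by rewrite /mrestr setIidl// => x /AD[].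
- by apply: measurable_funS mf => // x [].
- by rewrite /= /mrestr setDE -setIA setICl setI0 measure0.
Qed.

(** Rectangles form a generating pi-system of the product, so the two pushforwards coincide. The two
    sides may live on different spaces: here the tree and the walk. *)
Lemma pair_measure_unique d d1 d2 (T : measurableType d)
    (U1 : measurableType d1) (U2 : measurableType d2) d'
    (T' : measurableType d') (R : realType)
    (m : {finite_measure set T -> \bar R}) (m' : {measure set T' -> \bar R})
    (f1 : T -> U1) (f2 : T -> U2) (g1 : T' -> U1) (g2 : T' -> U2) :
  measurable_fun setT f1 -> measurable_fun setT f2 ->
  measurable_fun setT g1 -> measurable_fun setT g2 ->
  (forall A B, measurable A -> measurable B ->
    m (f1 @^-1` A `&` f2 @^-1` B) = m' (g1 @^-1` A `&` g2 @^-1` B)) ->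
  forall C : set (U1 * U2), measurable C ->
    m ((fun x => (f1 x, f2 x)) @^-1` C) = m' ((fun x => (g1 x, g2 x)) @^-1` C).
Proof.
move=> mf1 mf2 mg1 mg2 eqR C mC.
have mf := measurable_fun_pair mf1 mf2.
have mg := measurable_fun_pair mg1 mg2.
pose f : {mfun T >-> (U1 * U2)%type} := HB.pack (fun x => (f1 x, f2 x))
  (isMeasurableFun.Build _ _ _ _ _ mf).
pose g : {mfun T' >-> (U1 * U2)%type} := HB.pack (fun x => (g1 x, g2 x))
  (isMeasurableFun.Build _ _ _ _ _ mg).
apply: (measure_unique [set A `*` B | A in measurable & B in measurable]
  (fun=> setT) _ _ _ _ (pushforward m f) (pushforward m' g)) => //.
- by rewrite measurable_prod_measurableType.
- move=> _ _ [A mA [B mB <-]] [A' mA' [B' mB' <-]].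
  rewrite -setXI; exists (A `&` A'); first exact: measurableI.
  by exists (B `&` B') => //; exact: measurableI.
- by move=> _; exists setT => //; exists setT => //; rewrite setXTT.
- by rewrite bigcup_const//; exists 0%N.
- by move=> _ [A mA [B mB <-]]; exact: eqR.
- by move=> _; rewrite /= /pushforward preimage_setT -ge0_fin_numE//
    fin_num_measure.
Qed.

(** Both integrals are integrals of [h] against the same image measure on [U]. *)
Lemma ge0_integral_comp_unique d d1 d' (T : measurableType d)
    (U : measurableType d1) (T' : measurableType d') (R : realType)
    (m : {measure set T -> \bar R}) (m' : {measure set T' -> \bar R})
    (f : T -> U) (g : T' -> U) (h : U -> \bar R) :
  measurable_fun setT f -> measurable_fun setT g ->
  (forall A, measurable A -> m (f @^-1` A) = m' (g @^-1` A)) ->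
  measurable_fun setT h -> (forall u, 0 <= h u)%E ->
  forall A, measurable A ->
  (\int[m]_(x in f @^-1` A) h (f x) = \int[m']_(x in g @^-1` A) h (g x))%E.
Proof.
move=> mf mg eqm mh h0 A mA.
have mhA : measurable_fun A h by exact: measurable_funTS.
pose f' : {mfun T >-> U} := HB.pack f (isMeasurableFun.Build _ _ _ _ _ mf).
pose g' : {mfun T' >-> U} := HB.pack g (isMeasurableFun.Build _ _ _ _ _ mg).
have h0A : {in A, forall u, 0 <= h u}%E by [].
transitivity (\int[pushforward m f']_(u in A) h u)%E.
  by rewrite (ge0_integral_pushforward mf).
transitivity (\int[pushforward m' g']_(u in A) h u)%E.
  by apply: eq_measure_integral => B mB _; exact: eqm.
by rewrite (ge0_integral_pushforward mg).
Qed.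

(** * Positions and walks as finite sums of displacements *)

Section siblings_measurability.
Context (R : realType) (d : measure_display) (T : measurableType d).

Lemma measurable_sibling (j : nat) :
  measurable_fun [set: siblings R] (fun x : siblings R => (x j : R)).
Proof.
move=> _ B mB; rewrite setTI; apply: sub_sigma_algebra.
by exists j, B.
Qed.

(** The sigma-algebra on [T] is left arbitrary, so that this serves both for the ambient one and for
    the one generated by a history. Only proper prefixes of [v] enter the sum. *)
Lemma measurable_position (D : seq nat -> T -> siblings R) (v : seq nat) :
  (forall k, (k < size v)%N -> measurable_fun [set: T] (D (take k v))) ->
  measurable_fun [set: T] (position D v).
Proof.
move=> mD; rewrite /position.
apply: measurable_sum => k.
exact: (measurableT_comp (measurable_sibling _) (mD _ (ltn_ord k))).
Qed.

Lemma position_rcons (D : seq nat -> T -> siblings R) v j w :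
  position D (rcons v j) w = position D v w + D v w j.
Proof.
rewrite /position size_rcons big_ord_recr/= nth_rcons ltnn eqxx.
rewrite -[rcons v j in X in _ + X]cats1 take_size_cat//; congr (_ + _).
apply: eq_bigr => k _.
by rewrite -cats1 takel_cat ?nth_cat ?ltn_ord// ltnW.
Qed.

End siblings_measurability.

Lemma walkS (R : realType) (T : Type) (X : nat -> T -> R) k w :
  walk X k.+1 w = walk X k w + X k.+1 w.
Proof. by rewrite /walk big_nat_recr. Qed.

(** Applied both to the ambient sigma-algebra and to the one generated by the first k increments. *)
Lemma measurable_walk (R : realType) d (T : measurableType d)
    (X : nat -> T -> R) k :
  (forall i, (0 < i <= k)%N -> measurable_fun [set: T] (X i)) ->
  measurable_fun [set: T] (walk X k).
Proof.
elim: k => [|k IH] mX.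
  rewrite (_ : walk X 0 = cst 0)//.
  by apply/funext => w; rewrite /walk big_geq.
rewrite (_ : walk X k.+1 = walk X k \+ X k.+1); last first.
  by apply/funext => w; rewrite walkS.
apply: measurable_funD; last by apply: mX; rewrite leqnn.
by apply: IH => i /andP[i0 ik]; apply: mX; rewrite i0 leqW.
Qed.

(** * Tree shapes and history events *)

Section tree.
Context (R : realType) (n : nat) (b : brw R n) (d : measure_display)
  (T : measurableType d) (P : probability T R) (t : random_tree b P).

Local Notation N := (nchildren t).
Local Notation D := (disp t).

Let history_events k := [set E : set T | exists2 v : seq nat, (size v < k)%N &
   (exists c : nat, E = N v @^-1` [set c]) \/
   (exists2 C : set (siblings R), measurable C & E = D v @^-1` C)].

(* The first k generations of w and w0 carry the same labels and the same
   numbers of children. *)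
Definition same_shape (k : nat) (w0 : T) : set T :=
  [set w | forall j, (j < k)%N ->
     forall u, u \in generation t j w0 -> N u w = N u w0].

Lemma same_shapeS k w0 :
  same_shape k.+1 w0 = same_shape k w0 `&`
    [set w | forall u, u \in generation t k w0 -> N u w = N u w0].
Proof.
apply/seteqP; split=> w /=.
  by move=> h; split=> [j jk|]; apply: h => //; exact: ltnW.
by move=> [h hk] j; rewrite ltnS leq_eqVlt => /predU1P[->//|]; exact: h.
Qed.

Lemma generation_same_shape k w0 w :
  same_shape k w0 w -> generation t k w = generation t k w0.
Proof.
elim: k => // k IH; rewrite same_shapeS => -[/IH /= -> hk].
by congr flatten; apply/eq_in_map => u /hk ->.
Qed.

Lemma generation_rcons k w v j :
  rcons v j \in generation t k.+1 w -> v \in generation t k w.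
Proof. by move=> /allpairsPdep[u [i [uk _ /rcons_inj[-> _]]]]. Qed.

Lemma size_generation k w v : v \in generation t k w -> size v = k.
Proof.
elim: k v => [|k IH] v; first by rewrite inE => /eqP ->.
by move=> /allpairsPdep[u [i [uk _ ->]]]; rewrite size_rcons (IH u).
Qed.

Lemma uniq_generation k w : uniq (generation t k w).
Proof.
elim: k => // k IH; apply: allpairs_uniq_dep => //.
- by move=> u _; exact: iota_uniq.
- by move=> [u i] [u' i'] _ _ /= /rcons_inj[-> ->].
Qed.

Lemma history_setI k (E F : set T) :
  history N D k E -> history N D k F -> history N D k (E `&` F).
Proof.
exact: (@measurableI _ (g_sigma_algebraType (history_events k))).
Qed.

(** The generations of [w0] are finite lists, so this is a finite intersection of generators of the
    history. This is what allows conditioning on the shape in [branching]. *)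
Lemma history_same_shape k k' w0 :
  (k' <= k)%N -> history N D k (same_shape k' w0).
Proof.
change (is_true (k' <= k)%N ->
  (history_events k).-sigma.-measurable (same_shape k' w0)).
elim: k' => [_|k' IH k'k].
  by rewrite (_ : same_shape 0 w0 = setT)//; apply/seteqP; split.
rewrite same_shapeS; apply: measurableI; first exact: IH (ltnW k'k).
have : {in generation t k' w0, forall u, size u < k}%N.
  by move=> u /size_generation ->.
elim: (generation t k' w0) => [_|u s IHs sk].
  by rewrite [X in measurable X](_ : _ = setT)//; apply/seteqP; split.
rewrite [X in measurable X](_ : _ = N u @^-1` [set N u w0] `&`
  [set w | forall v, v \in s -> N v w = N v w0]); last first.
  apply/seteqP; split=> w /= h.
    by split=> [|v vs]; apply: h; rewrite inE ?eqxx// vs orbT.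
  by move=> v; rewrite inE => /predU1P[->|]; [exact: h.1|exact: h.2].
apply: measurableI; last by apply: IHs => v vs; apply: sk; rewrite inE vs orbT.
apply: sub_sigma_algebra; exists u; first by apply: sk; rewrite mem_head.
by left; exists (N u w0).
Qed.

(** A position involves only the displacements attached to proper prefixes of the label; hence
    length k itself is allowed, although the history stops strictly below k. *)
Lemma history_position k v (A : set R) :
  (size v <= k)%N -> measurable A -> history N D k (position D v @^-1` A).
Proof.
move=> vk mA.
pose HT := g_sigma_algebraType (history_events k).
apply: (@measurable_preimage _ _ HT _ (position D v)) => //.
apply: (@measurable_position _ _ HT) => j jv _ C mC.
rewrite setTI; apply: sub_sigma_algebra; exists (take j v).
  by rewrite size_takel (ltnW jv, leq_trans jv).
by right; exists C.
Qed.

Lemma measurable_history k E : history N D k E -> measurable E.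
Proof.
move=> HE.
apply: (smallest_sub (@sigma_algebra_measurable _ T) _ HE).
move=> _ [v _ [[c ->]|[C mC ->]]].
- exact: measurable_preimage (nchildren_measurable t v) _.
- exact: measurable_preimage (disp_measurable t v) _.
Qed.

Lemma measurable_same_shape k w0 : measurable (same_shape k w0).
Proof. exact: measurable_history (history_same_shape w0 (leqnn k)). Qed.

Lemma measurable_position_tree v : measurable_fun setT (position D v).
Proof. by apply: measurable_position => j _; exact: disp_measurable. Qed.

End tree.

(** * Law of a spine on a fixed shape *)

Section spine.
Context (R : realType) (n : nat) (b : brw R n) (d : measure_display)
  (T : measurableType d) (P : probability T R) (t : random_tree b P)
  (d' : measure_display) (T' : measurableType d') (P' : probability T' R)
  (X : nat -> T' -> R) (X_walk : is_random_walk b P' X)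
  (m_indep : forall i u v, (0 < i <= n)%N -> brw_m b i u = brw_m b i v).

Local Notation N := (nchildren t).
Local Notation D := (disp t).

Lemma measurable_random_walk k : (k <= n)%N -> measurable_fun setT (walk X k).
Proof.
move=> kn; apply: measurable_walk => i /andP[i0 ik].
by apply: (step_measurable X_walk); rewrite i0 (leq_trans ik).
Qed.

(** Rewrites the step law with the sibling kernel, which is measurable in the position of the
    parent. Child 0 stands for any child, since all have the same marginal. *)
Lemma walk_step_law k (A B : set R) :
  (k < n)%N -> measurable A -> measurable B ->
  (P' (walk X k @^-1` A `&` X k.+1 @^-1` B)
   = \int[P']_(w in walk X k @^-1` A)
       sibling_disp b k.+1 (walk X k w) [set x : siblings R | B (x 0%N)])%E.
Proof.
move=> kn mA mB; rewrite (step_law X_walk)//.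
  apply: eq_integral => w _; rewrite sibling_marginal//.
pose G := [set F : set T' | exists j : nat, (0 < j < k.+1)%N /\
             exists2 A : set R, measurable A & F = X j @^-1` A].
apply: (@measurable_preimage _ _ (g_sigma_algebraType G) _ (walk X k)) => //.
apply: (@measurable_walk _ _ (g_sigma_algebraType G)) => j jk _ C mC.
rewrite setTI; apply: sub_sigma_algebra; exists j; split => //.
by exists C.
Qed.

Let fine_ge0P (E : set T) : 0 <= fine (P E).
Proof. by apply: fine_ge0; exact: measure_ge0. Qed.

(** In the product given by [branching], the offspring factors do not see the positions and come out
    of the integral as a constant; the position 0 is an arbitrary reference point. The displacement
    factors of labels other than [v] have mass 1, and the integral left over is carried to the walk
    by the induction hypothesis. *)
Lemma branching_step k w0 v j (A B : set R) :
  (k < n)%N -> v \in generation t k w0 -> measurable A -> measurable B ->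
  (forall A, measurable A ->
    P (same_shape t k w0 `&` position D v @^-1` A)
    = P (same_shape t k w0) * P' (walk X k @^-1` A))%E ->
  (P (same_shape t k.+1 w0 `&`
      (position D v @^-1` A `&` (fun w => (D v w : nat -> R) j) @^-1` B))
   = (\prod_(u <- generation t k w0) offspring b k.+1 0%R [set N u w0]) *
     (P (same_shape t k w0) * P' (walk X k @^-1` A `&` X k.+1 @^-1` B)))%E.
Proof.
move=> kn vk mA mB IH.
set S := same_shape t k w0.
set s := generation t k w0.
have mS : measurable S by exact: measurable_same_shape.
have szv : size v = k by exact: size_generation vk.
pose BJ i := [set x : siblings R | B (x i)].
have mBJ i : measurable (BJ i).
  exact: measurable_preimage (measurable_sibling i) mB.
(* Only child [j] of [v] is constrained. *)
pose C u := if u == v then BJ j else setT.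
have mC u : measurable (C u) by rewrite /C; case: ifP.
have mpos : measurable_fun setT (position D v).
  exact: measurable_position_tree.
have mE : measurable (S `&` position D v @^-1` A).
  by apply: measurableI => //; exact: measurable_preimage.
have knT : (0 < k.+1 <= n)%N by [].
rewrite [X in P X](_ : _ = (S `&` position D v @^-1` A) `&`
    [set w | forall u, u \in s -> N u w = N u w0 /\ C u (D u w)]); last first.
  rewrite same_shapeS; apply/seteqP; split=> w /=.
    move=> [[Sw Nw] [Aw Bw]]; split=> // u us; split; first exact: Nw.
    by rewrite /C; case: eqP => // ->.
  move=> [[Sw Aw] h]; split; split=> //.
    by move=> u us; have [] := h u us.
  by have [_] := h _ vk; rewrite /C eqxx.
rewrite (branching (r := t) (k := k)) //; first last.
- by move=> u /size_generation.
- exact: uniq_generation.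
- apply: history_setI; first exact: history_same_shape.
  by apply: history_position; rewrite ?szv.
set q := (\prod_(u <- s) _)%E.
have q0 : (0 <= q)%E by apply: prode_ge0 => u _; exact: measure_ge0.
pose h u : \bar R := sibling_disp b k.+1 u (BJ 0%N).
have mh : measurable_fun setT h by exact: measurable_kernel.
have h0 u : (0 <= h u)%E by exact: measure_ge0.
transitivity
  (\int[P]_(w in S `&` position D v @^-1` A) (q * h (position D v w)))%E.
  apply: eq_integral => w _; rewrite big_split/=; congr (_ * _)%E.
    apply: eq_bigr => u _; apply: offspring_only_m => //; exact: m_indep.
  (* Only the factor of [v] survives; it concerns child [j], while [h] concerns child 0, and
     [sibling_marginal] identifies the two. *)
  rewrite (bigD1_seq v)//=; last exact: uniq_generation.
  rewrite big1 ?mule1 => [|u uv].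
    by rewrite /C eqxx /h /BJ !sibling_marginal.
  by rewrite /C (negbTE uv) prob_kernel.
rewrite ge0_integralZl//; last first.
  by apply: measurable_funTS; exact: measurableT_comp.
congr (_ * _)%E.
rewrite setIC -(ge0_integral_mrestr P mS)//; last first.
- by apply: measurable_funTS; exact: measurableT_comp.
- exact: measurable_preimage.
(* By hypothesis, the position of [v] under [P] restricted to [S] has the law of the walk multiplied
   by the scalar P(S), so the integral can be transferred. *)
pose pS := NngNum (fine_ge0P S).
rewrite (@ge0_integral_comp_unique _ _ _ _ _ _ _ _ (mscale pS P')
  _ (walk X k))//.
- rewrite ge0_integral_mscale//=.
  + by rewrite fineK ?fin_num_measure// walk_step_law.
  + apply: measurable_preimage => //.
    by apply: measurable_random_walk; exact: ltnW.
  + apply: measurable_funTS; apply: measurableT_comp => //.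
    by apply: measurable_random_walk; exact: ltnW.
- by apply: measurable_random_walk; exact: ltnW.
- move=> A' mA'; rewrite /= /mrestr /mscale/= fineK ?fin_num_measure//.
  by rewrite setIC IH.
Qed.

(* The joint law of (position of the parent, displacement) is determined by
   rectangles, which branching_step computes. *)
Lemma spine_law v w0 (A : set R) :
  (size v <= n)%N -> v \in generation t (size v) w0 -> measurable A ->
  (P (same_shape t (size v) w0 `&` position D v @^-1` A)
   = P (same_shape t (size v) w0) * P' (walk X (size v) @^-1` A))%E.
Proof.
(* Induction from the right end of the label: its last letter selects the last displacement of the
   spine. *)
elim/last_ind: v A => [|v j IH] A.
  move=> _ _ mA; rewrite (_ : same_shape t 0 w0 = setT); last first.
    by apply/seteqP; split.
  have -> : position D [::] = cst 0.
    by apply/funext => w; rewrite /position big_ord0.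
  have -> : walk X 0 = cst 0.
    by apply/funext => w; rewrite /walk big_geq.
  rewrite setTI probability_setT mul1e !preimage_cst.
  by case: ifP => _; rewrite ?measure0// !probability_setT.
rewrite size_rcons => kn vjk mA.
have vk := generation_rcons vjk.
have {}IH := IH _ (ltnW kn) vk.
set k := size v in kn vjk vk IH *.
have mS : measurable (same_shape t k.+1 w0) by exact: measurable_same_shape.
have step := branching_step j kn vk _ _ IH.
set q := (\prod_(u <- _) _)%E in step.
(* Taking both sets to be the whole line identifies the constant [q] as the factor from P of the
   shape at level k to level k+1, so [step] becomes a product formula on rectangles. *)
have eqS : (P (same_shape t k.+1 w0) = q * P (same_shape t k w0))%E.
  have := step setT setT measurableT measurableT.
  by rewrite !preimage_setT !setIT probability_setT mule1.
have mD : measurable_fun setT (fun w => (D v w : nat -> R) j).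
  exact: (measurableT_comp (measurable_sibling j) (disp_measurable t v)).
have mX : measurable_fun setT (X k.+1) by exact: (step_measurable X_walk).
pose pS := NngNum (fine_ge0P (same_shape t k.+1 w0)).
have := @pair_measure_unique _ _ _ _ _ _ _ _ _ (mrestr P mS) (mscale pS P')
  _ _ _ _ (measurable_position_tree t v) mD
  (measurable_random_walk (ltnW kn)) mX.
(* The new position is the sum of the pair (parent position, displacement), so the required event is
   the preimage of [A] under addition. *)
have mA2 : measurable ((fun z : R * R => z.1 + z.2) @^-1` A).
  apply: measurable_preimage => //; apply: measurable_funD.
  - exact: measurable_fst.
  - exact: measurable_snd.
move=> /(_ _ _ mA2).
rewrite /= /mrestr /mscale/= fineK ?fin_num_measure// => eqP.
rewrite setIC.
rewrite [X in P (X `&` _)](_ : _ =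
    (fun w => (position D v w, (D v w : nat -> R) j)) @^-1`
    ((fun z : R * R => z.1 + z.2) @^-1` A)); last first.
  by apply/funext => w; rewrite /preimage/= position_rcons.
rewrite eqP.
  by congr (_ * P' _)%E; apply/funext => w; rewrite /preimage/= walkS.
by move=> A1 B1 mA1 mB1; rewrite setIC step// eqS muleA.
Qed.

End spine.

(** * Deterministic quantiles of a finite sample *)

Section empirical_quantile.
Context (R : realType).
Implicit Types (s : seq R) (x a : R).

(** With [right_gap], finiteness of the sample provides intervals free of sample points next to [x];
    they replace one-sided limits of the empirical distribution function. *)
Lemma left_gap s x : exists2 y, y < x & {in s, forall z, z < x -> z <= y}.
Proof.
elim: s => [|z s [y yx ys]]; first by exists (x - 1) => //; lra.
have [zx|xz] := ltP z x; last first.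
  exists y => // u; rewrite inE => /predU1P[->|/ys//].
  by rewrite ltNge xz.
exists (Num.max y z); first by rewrite gt_max yx.
move=> u; rewrite inE le_max => /predU1P[->|us ux]; first by rewrite lexx orbT.
by rewrite ys.
Qed.

Lemma right_gap s x : exists2 y, x < y & {in s, forall z, z < y -> z <= x}.
Proof.
elim: s => [|z s [y yx ys]]; first by exists (x + 1) => //; lra.
have [zx|xz] := leP z x.
  by exists y => // u; rewrite inE => /predU1P[->|/ys].
exists (Num.min y z); first by rewrite lt_min yx.
move=> u; rewrite inE lt_min => /predU1P[->|us /andP[uy _]].
  by rewrite ltxx andbF.
exact: ys.
Qed.

Lemma sub_in_count (T : eqType) (p q : pred T) (s : seq T) :
  {in s, forall z, p z -> q z} -> (count p s <= count q s)%N.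
Proof.
elim: s => //= z s IH h; apply: leq_add.
  by have := h z (mem_head _ _); case: (p z) => // ->.
by apply: IH => u us; apply: h; rewrite inE us orbT.
Qed.

Section fixed_sample.
Context (s : seq R) (alpha : R) (s_gt0 : (0 < size s)%N)
  (alpha_gt0 : 0 < alpha) (alpha_le1 : alpha <= 1).

Let A := [set x : R | alpha <= (count (fun z => z <= x) s)%:R / (size s)%:R].

Let AE x : A x <-> alpha * (size s)%:R <= (count (fun z => z <= x) s)%:R.
Proof. by rewrite /A/= ler_pdivlMr// ltr0n. Qed.

(** An upper bound of the sample lies in [A] because alpha is at most 1; strictly below the sample
    the count is 0, which alpha > 0 excludes. *)
Let has_infA : has_inf A.
Proof.
have size_gt0 : 0 < (size s)%:R :> R by rewrite ltr0n.
split.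
  have [y ys] : exists y, {in s, forall z, z <= y}.
    elim: (s) => [|z s' [y ys]]; first by exists 0.
    exists (Num.max y z) => u; rewrite inE le_max => /predU1P[->|/ys -> //].
    by rewrite lexx orbT.
  exists y; apply/AE.
  have /eqP -> : count (fun z => z <= y) s == size s.
    by rewrite -all_count; exact/allP.
  by rewrite ler_piMl// ltW.
have [y ys] : exists y, {in s, forall z, y < z}.
  elim: (s) => [|z s' [y ys]]; first by exists 0.
  exists (Num.min y (z - 1)) => u; rewrite inE gt_min => /predU1P[->|/ys -> //].
  by apply/orP; right; lra.
exists y => x /AE; rewrite leNgt; apply: contraNle => xy.
rewrite (_ : count _ _ = 0%N) ?mulr_gt0//.
apply/eqP; rewrite -leqn0 leqNgt -has_count.
by apply/hasPn => z /ys; rewrite -ltNge; exact: lt_trans.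
Qed.

(** The infimum is attained: if [x] is not in [A], the count stays constant up to the right gap,
    which keeps [inf A] strictly above [x]. *)
Lemma quantile_le x :
  (inf A <= x) = (alpha * (size s)%:R <= (count (fun z => z <= x) s)%:R).
Proof.
apply/idP/idP => [|/AE Ax]; last by apply: ge_inf => //; case: has_infA.
rewrite leNgt; apply: contraNle => ltax.
have [y xy ys] := right_gap s x.
apply: (lt_le_trans xy); apply: lb_le_inf; first by case: has_infA.
move=> z /AE Az; rewrite leNgt; apply/negP => zy.
move: ltax; rewrite ltNge (le_trans Az)// ler_nat.
by apply: sub_in_count => u us uz; apply: ys => //; exact: le_lt_trans zy.
Qed.

(** If the points strictly below [x] already suffice, so do those up to some y < x given by the left
    gap, and then [inf A] is at most y. *)
Lemma le_quantile x :
  (x <= inf A) = ((count (fun z => z < x) s)%:R < alpha * (size s)%:R).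
Proof.
apply/idP/idP => [|ltax].
  rewrite ltNge; apply: contraTN => ltax; rewrite -ltNge.
  have [y yx ys] := left_gap s x.
  apply: le_lt_trans yx; apply: ge_inf; first by case: has_infA.
  by apply/AE; rewrite (le_trans ltax)// ler_nat; exact: sub_in_count.
apply: lb_le_inf; first by case: has_infA.
move=> z /AE Az; rewrite leNgt; apply/negP => zx.
move: ltax; rewrite ltNge (le_trans Az)// ler_nat.
by apply: sub_in_count => u us uz; exact: le_lt_trans zx.
Qed.

(** An equivalence rather than a bound, since it also yields the measurability of the deviation
    event. *)
Lemma quantile_deviationE a lambda :
  (lambda <= `|inf A - a|) =
  (alpha * (size s)%:R <= (count (fun z => (z <= a - lambda)%R) s)%:R)
  || ((count (fun z => (z < a + lambda)%R) s)%:R < alpha * (size s)%:R).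
Proof.
rewrite -quantile_le -le_quantile ler_normr orbC; congr (_ || _).
  by apply/idP/idP; lra.
by apply/idP/idP; lra.
Qed.

Lemma quantile_deviation_count a lambda theta :
  theta <= alpha <= 1 - theta ->
  lambda <= `|inf A - a| ->
  theta * (size s)%:R <= (count (fun z => (lambda <= `|z - a|)%R) s)%:R.
Proof.
move=> /andP[ta at1]; have s0 : 0 <= (size s)%:R :> R by [].
rewrite quantile_deviationE => /orP[h|h].
  apply: (@le_trans _ _ (alpha * (size s)%:R)); first exact: ler_wpM2r.
  apply: (le_trans h); rewrite ler_nat; apply: sub_count => z /= zl.
  by rewrite ler_normr; apply/orP; right; lra.
(* Deviation to the right: fewer than a fraction alpha lies below a + lambda, so more than 1 - alpha
   >= theta lies at or beyond it. *)
apply: (@le_trans _ _ (count (predC (fun z => (z < a + lambda)%R)) s)%:R).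
  have := count_predC (fun z => (z < a + lambda)%R) s.
  move=> /(congr1 (fun k => k%:R : R)); rewrite natrD => e.
  have : theta * (size s)%:R <= (1 - alpha) * (size s)%:R.
    by apply: ler_wpM2r => //; lra.
  lra.
rewrite ler_nat; apply: sub_count => z /=; rewrite -leNgt => zl.
by rewrite ler_normr; apply/orP; left; lra.
Qed.

End fixed_sample.
End empirical_quantile.

(** * Markov's inequality and measurability for counts *)

(** Integrate the pointwise lower bound over [F], then enlarge [F] to [E] in each term. *)
Lemma markov_sum_indic d (T : measurableType d) (R : realType)
    (P : {measure set T -> \bar R}) (I : Type) (g : seq I) (B : I -> set T)
    (E F : set T) (r : R) :
  measurable E -> measurable F -> (forall i, measurable (B i)) -> F `<=` E ->
  0 <= r ->
  (forall w, F w -> r <= \sum_(i <- g) \1_(B i) w) ->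
  (r%:E * P F <= \sum_(i <- g) P (E `&` B i))%E.
Proof.
move=> mE mF mB FE r0 rB.
have mI i : measurable_fun F (fun w => (\1_(B i) w : R)%:E).
  by apply/measurable_EFinP; apply: measurable_funTS; exact: measurable_indic.
rewrite -(integral_cst P mF).
apply: (@le_trans _ _ (\int[P]_(w in F) \sum_(i <- g) (\1_(B i) w : R)%:E)%E).
  apply: ge0_le_integral => //.
  - by apply: emeasurable_sum.
  - by move=> w Fw /=; rewrite sumEFin lee_fin; exact: rB.
rewrite ge0_integral_sum//; apply: lee_sum => i _.
rewrite integral_indic// setIC; apply: le_measure; rewrite ?inE.
- exact: measurableI.
- exact: measurableI.
- exact: setSI.
Qed.

Lemma measurable_count_ge d (T : measurableType d) (R : realType) (I : Type)
    (g : seq I) (f : I -> T -> R) (p : pred R) (r : R) :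
  (forall i, measurable_fun setT (f i)) -> measurable [set x | p x] ->
  measurable [set w | r <= (count (fun i => p (f i w)) g)%:R].
Proof.
move=> mf mp.
pose h w : R := \sum_(i <- g) \1_(f i @^-1` [set x | p x]) w.
have mh : measurable_fun setT h.
  apply: measurable_sum => i; apply: measurable_indic.
  exact: measurable_preimage.
rewrite (_ : [set w | _] = h @^-1` `[r, +oo[%classic).
  exact: measurable_preimage.
apply/funext => w; rewrite /preimage/= in_itv/= andbT; congr (is_true (r <= _)).
rewrite /h -sum1_count natr_sum big_mkcond/=; apply: eq_bigr => i _.
by rewrite indicE mem_setE/= /in_mem/=; case: (p _).
Qed.

(** * Countable decomposition according to the shape *)

Section shapes.
Context (R : realType) (n : nat) (b : brw R n) (d : measure_display)
  (T : measurableType d) (P : probability T R) (t : random_tree b P).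

Local Notation N := (nchildren t).

(* code takes values in a countType, so there are countably many shapes. *)
Let code w := [seq [seq (u, N u w) | u <- generation t j w] | j <- iota 0 n].

Let code_same_shape w w0 : code w = code w0 <-> same_shape t n w0 w.
Proof.
split=> [/eq_in_map eq_code j jn|shape_w].
  have := eq_code j; rewrite mem_iota => /(_ jn) eqj.
  have eqg : generation t j w = generation t j w0.
    by move/(congr1 unzip1): eqj; rewrite /unzip1 -!map_comp !map_id.
  by move: eqj; rewrite eqg => /eq_in_map eqN u /eqN[].
apply/eq_in_map => j; rewrite mem_iota => /= jn.
rewrite (@generation_same_shape _ _ _ _ _ _ t j w0); last first.
  by move=> i ij; apply: shape_w; exact: ltn_trans jn.
by apply/eq_in_map => u uj; rewrite (shape_w j).
Qed.

Let shape (i : nat) : set T := [set w | pickle (code w) = i].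

(** Indices that encode no realized shape give the empty set, hence the alternative. *)
Let shapeP (i : nat) : shape i = set0 \/ exists w0, shape i = same_shape t n w0.
Proof.
have [->|/set0P[w0 <-]] := eqVneq (shape i) set0; first by left.
right; exists w0; apply/seteqP; split=> w.
  by move=> /(pcan_inj (@pickleK _)) /code_same_shape.
by move=> /code_same_shape; rewrite /shape/= => ->.
Qed.

Let bigcup_shape (F : set T) : F = \bigcup_i (F `&` shape i).
Proof.
apply/seteqP; split=> w; last by case=> i _ [].
by move=> Fw; exists (pickle (code w)).
Qed.

Let trivIset_shape (F : set T) : trivIset setT (fun i => F `&` shape i).
Proof. by move=> i j _ _ [w [[_ <-] [_ <-]]]. Qed.

Let measurable_setI_shape (F : set T) i :
  (forall w0, measurable (F `&` same_shape t n w0)) ->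
  measurable (F `&` shape i).
Proof. by move=> mF; have [->|[w0 ->]] := shapeP i; rewrite ?setI0. Qed.

Lemma measurable_of_shapes (F : set T) :
  (forall w0, measurable (F `&` same_shape t n w0)) -> measurable F.
Proof.
move=> mF; rewrite (bigcup_shape F); apply: bigcup_measurable => i _.
exact: measurable_setI_shape.
Qed.

(** The nonempty classes [shape i] partition [T], so countable additivity sums the bounds known on
    each shape. *)
Lemma le_measure_shapes (F G : set T) (r : R) :
  0 <= r ->
  (forall w0, measurable (F `&` same_shape t n w0)) ->
  (forall w0, measurable (G `&` same_shape t n w0)) ->
  (forall w0,
    P (F `&` same_shape t n w0) <= r%:E * P (G `&` same_shape t n w0))%E ->
  (P F <= r%:E * P G)%E.
Proof.
move=> r0 mF mG FG.
have PE (H : set T) : (forall w0, measurable (H `&` same_shape t n w0)) ->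
    (P H = \sum_(0 <= i <oo) P (H `&` shape i))%E.
  move=> mH; rewrite {1}(bigcup_shape H) measure_semi_bigcup//.
  - by move=> i; exact: measurable_setI_shape.
  - by rewrite -bigcup_shape; exact: measurable_of_shapes.
rewrite (PE F)// (PE G)// -nneseriesZl//; apply: lee_nneseries => // i _.
by have [->|[w0 ->]] := shapeP i; rewrite ?setI0 ?measure0 ?mule0.
Qed.

End shapes.

(** * The quantile of generation n on a fixed shape *)

Section tree_quantile.
Context (R : realType) (n : nat) (b : brw R n) (d : measure_display)
  (T : measurableType d) (P : probability T R) (t : random_tree b P).

Local Notation D := (disp t).
Local Notation nonempty := [set w | (0 < gen_size t n w)%N].

Lemma gen_positions_same_shape k w0 w : same_shape t k w0 w ->
  gen_positions t k w = [seq position D v w | v <- generation t k w0].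
Proof. by move=> /generation_same_shape e; rewrite /gen_positions e. Qed.

Lemma gen_size_same_shape k w0 w : same_shape t k w0 w ->
  gen_size t k w = gen_size t k w0.
Proof. by move=> /generation_same_shape e; rewrite /gen_size e. Qed.

Lemma nonempty_same_shape w0 :
  nonempty `&` same_shape t n w0 =
  if (0 < gen_size t n w0)%N then same_shape t n w0 else set0.
Proof.
apply/seteqP; split=> w /=.
  by move=> [Zw Ew]; rewrite -(gen_size_same_shape Ew) Zw.
by case: ifP => // Z0 Ew; rewrite (gen_size_same_shape Ew).
Qed.

(** On one shape the list of labels is frozen, so the deviation is a Boolean combination of two
    counting events: [M1] for the left, the complement of [M2] for the right. *)
Lemma measurable_quantile_deviation alpha a lambda w0 :
  0 < alpha <= 1 ->
  measurable ([set w | lambda <= `|quantile t n alpha w - a|] `&` nonempty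
    `&` same_shape t n w0).
Proof.
move=> /andP[a0 a1].
rewrite -setIA nonempty_same_shape; case: ifP => Z0; last by rewrite setI0.
set g := generation t n w0.
pose M1 := [set w | alpha * (size g)%:R <=
  (count (fun v => position D v w <= a - lambda) g)%:R].
pose M2 := [set w | alpha * (size g)%:R <=
  (count (fun v => position D v w < a + lambda) g)%:R].
have mD v : measurable_fun setT (position D v).
  exact: measurable_position_tree.
have mM1 : measurable M1.
  apply: (@measurable_count_ge _ _ _ _ g (position D)
    (fun z => z <= a - lambda)) => //.
  by rewrite (_ : [set x | _] = `]-oo, a - lambda]%classic).
have mM2 : measurable M2.
  apply: (@measurable_count_ge _ _ _ _ g (position D)
    (fun z => z < a + lambda)) => //.
  by rewrite (_ : [set x | _] = `]-oo, a + lambda[%classic).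
have mE : measurable (same_shape t n w0) by exact: measurable_same_shape.
rewrite (_ : _ `&` _ = (M1 `|` ~` M2) `&` same_shape t n w0).
  by apply: measurableI => //; apply: measurableU => //; exact: measurableC.
have dev w : same_shape t n w0 w ->
    (lambda <= `|quantile t n alpha w - a|) =
    (alpha * (size g)%:R <=
      (count (fun v => position D v w <= a - lambda) g)%:R)
    || ((count (fun v => position D v w < a + lambda) g)%:R <
      alpha * (size g)%:R).
  move=> Ew; have := @quantile_deviationE _ (gen_positions t n w) alpha.
  rewrite size_map -/(gen_size t n w) (gen_size_same_shape Ew).
  move=> /(_ Z0 a0 a1 a lambda).
  rewrite /quantile (gen_size_same_shape Ew) => ->.
  by rewrite (gen_positions_same_shape Ew) !count_map.
apply/seteqP; split=> w /= [h Ew]; split=> //.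
  move: h; rewrite dev// => /orP[|]; first by left.
  by right; apply/negP; rewrite -ltNge.
by rewrite dev//; case: h => [->//|/negP]; rewrite -ltNge => ->; rewrite orbT.
Qed.

End tree_quantile.

(** * Assembly of the deviation bound *)

Theorem theorem2p1 (R : realType) (n : nat) (n_gt0 : (0 < n)%N)
  (b : brw R n)
  (d : measure_display) (T : measurableType d) (P : probability T R)
  (t : random_tree b P)
  (d' : measure_display) (T' : measurableType d') (P' : probability T' R)
  (X : nat -> T' -> R) (X_walk : is_random_walk b P' X)
  (Sn_integrable : P'.-integrable [set: T'] (EFin \o walk X n))
  (m_indep : forall i u v, (0 < i <= n)%N -> brw_m b i u = brw_m b i v)
  (c : R) (c_gt0 : 0 < c)
  (chernoff : forall lambda : R, 0 < lambda ->
     (P' [set w | (lambda <= `|walk X n w - fine ('E_P' [walk X n])|)%R]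
       <= (expR (- (c * lambda ^+ 2 / n%:R)))%:E)%E)
  (mu : R) (mu_mean : n%:R * mu = fine ('E_P' [walk X n]))
  (lambda : R) (lambda_gt0 : 0 < lambda)
  (alpha : R)
  (alpha_range : expR (- (2^-1 * c * lambda ^+ 2 / n%:R)) <= alpha
                 <= 1 - expR (- (2^-1 * c * lambda ^+ 2 / n%:R))) :
  cond_prob P [set w | lambda <= `|quantile t n alpha w - n%:R * mu|]
              [set w | (0 < gen_size t n w)%N]
  <= 2 * expR (- (2^-1 * c * lambda ^+ 2 / n%:R)).
Proof.
have := chernoff lambda lambda_gt0; rewrite -mu_mean.
(* The exponent of theta is half that of Chernoff, so the walk deviates with probability at most
   theta^2: one factor will pay for Markov, the other is the bound. *)
rewrite (_ : expR (- (c * lambda ^+ 2 / n%:R)) =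
  expR (- (2^-1 * c * lambda ^+ 2 / n%:R)) ^+ 2); last first.
  rewrite [RHS]expr2 -expRD; congr expR; lra.
have := expR_gt0 (- (2^-1 * c * lambda ^+ 2 / n%:R)).
move: alpha_range; set theta := expR _; set a := n%:R * mu.
move=> alpha_range theta_gt0 walk_tail.
have alpha01 : 0 < alpha <= 1 by apply/andP; split; lra.
set G := [set w | (0 < gen_size t n w)%N].
set F := [set w | _ <= _].
have mG w0 : measurable (G `&` same_shape t n w0).
  rewrite nonempty_same_shape; case: ifP => // _.
  exact: measurable_same_shape.
have mFG w0 : measurable (F `&` G `&` same_shape t n w0).
  exact: measurable_quantile_deviation.
pose B := [set x : R | lambda <= `|x - a|].
have mB : measurable B.
  rewrite (_ : B = (fun x => `|x - a|) @^-1` `[lambda, +oo[%classic).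
    apply: measurable_preimage => //; apply: measurableT_comp => //.
    exact: measurable_funB.
  by apply/seteqP; split=> x; rewrite /B/= in_itv/= andbT.
(* The conditional probability is thus at most theta, within the stated 2 theta; when P(G) = 0 the
   quotient is 0 by convention. *)
suff FG : (P (F `&` G) <= theta%:E * P G)%E.
  have mGT : measurable G by exact: measurable_of_shapes mG.
  have mFGT : measurable (F `&` G) by exact: measurable_of_shapes mFG.
  rewrite /cond_prob.
  have : fine (P (F `&` G)) <= theta * fine (P G).
    by rewrite -lee_fin EFinM !fineK ?fin_num_measure.
  have : 0 <= fine (P G) by apply: fine_ge0.
  rewrite le_eqVlt => /predU1P[<- _|PG0 h].
    by rewrite invr0 mulr0 mulr_ge0// ltW.
  by rewrite ler_pdivrMr//; nra.
apply: (le_measure_shapes (ltW theta_gt0) mFG mG) => w0.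
set E := same_shape t n w0 in mG mFG *.
have mE : measurable E by exact: measurable_same_shape.
have := mFG w0; rewrite -/E -setIA nonempty_same_shape -/E.
case: ifP => [Z0 mFE|_ _]; last by rewrite setI0 measure0 mule0.
set g := generation t n w0.
have mpos v : measurable (position (disp t) v @^-1` B).
  by apply: measurable_preimage => //; exact: measurable_position_tree.
have Zr : 0 < (size g)%:R :> R by rewrite ltr0n.
have FE_E : F `&` E `<=` E by move=> w [].
(* The Markov threshold: a deviating quantile forces at least theta times the generation size of
   individuals into [B]. *)
have r0 : 0 <= theta * (size g)%:R by rewrite mulr_ge0// ltW.
have := @markov_sum_indic _ _ _ P _ g (fun v => position (disp t) v @^-1` B)
  _ _ _ mE mFE mpos FE_E r0.
have spine v : v \in g ->
    (P (E `&` position (disp t) v @^-1` B) = P E * P' (walk X n @^-1` B))%E.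
  move=> vg; have szv := size_generation vg.
  have := @spine_law _ _ _ _ _ _ t _ _ _ _ X_walk m_indep v w0 B.
  by rewrite szv; exact.
have mS : measurable (walk X n @^-1` B).
  by apply: measurable_preimage => //; exact: measurable_random_walk X_walk _ _.
rewrite (eq_big_seq _ spine) => markov.
have {}markov : (theta * (size g)%:R) * fine (P (F `&` E)) <=
    (size g)%:R * (fine (P E) * fine (P' (walk X n @^-1` B))).
  rewrite -lee_fin !EFinM !fineK ?fin_num_measure//.
  rewrite -EFinM; apply: (le_trans (markov _)).
    move=> w [Fw Ew].
    have := @quantile_deviation_count _ (gen_positions t n w) alpha
      _ _ _ a lambda theta.
    rewrite size_map -/(gen_size t n w) (gen_size_same_shape Ew).
    move=> /(_ Z0) h; apply: le_trans.
      apply: h => //; [lra|lra|].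
      by move: Fw; rewrite /F/= /quantile (gen_size_same_shape Ew).
    rewrite (gen_positions_same_shape Ew) count_map.
    rewrite -sum1_count natr_sum big_mkcond/=.
    apply: ler_sum => v _; case: ifP => [Bv|_]; last by rewrite indicE.
    by rewrite indicE mem_set.
  have -> : (P E * P' (walk X n @^-1` B) =
      (fine (P E) * fine (P' (walk X n @^-1` B)))%:E)%E.
    by rewrite EFinM !fineK ?fin_num_measure.
  by rewrite sumEFin -EFinM lee_fin big_tnth sumr_const card_ord mulr_natl.
rewrite -[leLHS]fineK ?fin_num_measure// -[P E]fineK ?fin_num_measure//.
rewrite -EFinM lee_fin.
have q_le : fine (P' (walk X n @^-1` B)) <= theta ^+ 2.
  by rewrite -lee_fin fineK ?fin_num_measure.
have PE0 : 0 <= fine (P E) by apply: fine_ge0.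
(* Multiplying by theta times the size of [g], positive as this generation is non-empty, reduces the
   goal to [markov] combined with [q_le]. *)
rewrite -(ler_pM2l (mulr_gt0 theta_gt0 Zr)); apply: (le_trans markov).
rewrite [leRHS](_ : _ = (size g)%:R * (fine (P E) * theta ^+ 2)); last by ring.
by apply: ler_wpM2l; [exact: ltW|exact: ler_wpM2l].
Qed.
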